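(* Let $p\ge1$, $s,t\ge0$, $a_1,\dots,a_p,b_1,\dots,b_p\ge1$ be integers. For an integer $z$ write $z=2p\,\bar z+\hat z$ with $\bar z\in\mathbb Z$ and $0\le\hat z<2p$. The recurrence $$H(n)=H\Big(n-s-\sum_{i=1}^pH(n-a_i)\Big)+H\Big(n-t-\sum_{i=1}^pH(n-b_i)\Big)$$ is formally satisfied by the sequence $\lceil n/2p\rceil$ for all integers $n$, i.e. $$\Big\lceil\frac{n}{2p}\Big\rceil=\Big\lceil\frac{n-s-\sum_{i=1}^p\lceil (n-a_i)/2p\rceil}{2p}\Big\rceil+\Big\lceil\frac{n-t-\sum_{i=1}^p\lceil (n-b_i)/2p\rceil}{2p}\Big\rceil\quad\text{for all } n\in\mathbb Z,$$ if and only if all of the following hold: (1) for each $j\in\{0,1,\dots,p-1\}$, at most $j$ of the $\hat a_i$ satisfy $\hat a_i\le j$ and at most $j$ of them satisfy $\hat a_i\ge 2p-j$; (2) for each $j\in\{0,1,\dots,p-1\}$, at most $j$ of the $\hat b_i$ satisfy $\hat b_i\le j$ and at most $j$ of them satisfy $\hat b_i\ge 2p-j$; (3) there is an integer $d$ such that either $-s+\sum_{i=1}^p\bar a_i=2pd$ and $-t+\sum_{i=1}^p\bar b_i=-2pd-p$, or $-s+\sum_{i=1}^p\bar a_i=-2pd-p$ and $-t+\sum_{i=1}^p\bar b_i=2pd$. *)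

(* Defs.v *)
From mathcomp Require Import all_boot all_order all_algebra.

Set Implicit Arguments.
Unset Strict Implicit.
Unset Printing Implicit Defensive.

Import Order.TTheory GRing.Theory Num.Theory.
Local Open Scope ring_scope.

(* z = 2p * zbar p z + zhat p z; for p >= 1 the divisor is positive, so divz is
   floor division and 0 <= zhat p z < 2p. *)
Definition zbar (p : nat) (z : int) : int := (z %/ (2 * p%:Z))%Z.
Definition zhat (p : nat) (z : int) : int := (z %% (2 * p%:Z))%Z.

Definition ceil2p (p : nat) (n : int) : int :=
  Num.ceil (n%:~R / (2 * p%:R) : rat).

(* Formal satisfaction: the recurrence holds at every integer n, with H defined
   on all of Z, so that no initial conditions are involved. *)
Definition formally_satisfies (p : nat) (s t : int) (a b : 'I_p -> int)
    (H : int -> int) : Prop :=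
  forall n : int,
    H n = H (n - s - \sum_(i < p) H (n - a i))
        + H (n - t - \sum_(i < p) H (n - b i)).

Definition residues_spread (p : nat) (a : 'I_p -> int) : Prop :=
  forall j : nat, (j < p)%N ->
    (#|[set i : 'I_p | (zhat p (a i) <= j%:Z)%R]| <= j)%N /\
    (#|[set i : 'I_p | (2 * p%:Z - j%:Z <= zhat p (a i))%R]| <= j)%N.

(* Main.v *)
(** Write n = 2pq + r with 1 <= r <= 2p, let A(r) be the number of i with the
    residue of a_i below r, and u(r) = r - A(r); define v(r) similarly from b.
    With sigma = -s + sum abar_i and tau = -t + sum bbar_i the recurrence reads
    q + 1 = H(pq + u(r) + sigma) + H(pq + v(r) + tau),
    and conditions (1), (2) say 1 <= u(r), v(r) <= p for 1 <= r <= 2p.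
    Adding two instances with consecutive q and using
    H(x) + H(x - p) = K(x) := ceil(x/p) gives
    K(pq + u + sigma) + K(pq + v + tau) = 2q + 1.
    As u(2p) = v(2p) = p, the case q = -1, r = 2p is K(sigma) + K(tau) = -1,
    whereas q = 0, r = 1 gives a sum of 1 at arguments that are larger by at
    most 1. So p divides sigma and tau, and the quotients add up to -1, which is
    (3). What remains is K(u) + K(v) = 2. For r <= p both terms are at most 1,
    for r > p both are at least 1; hence both equal 1.
    Conversely H(pq + u) does not depend on u in [1, p], so under (1)-(3) the
    right-hand side is K(pq + p) = q + 1. *)

Require Import Defs.
From mathcomp Require Import all_boot all_order all_algebra.
From mathcomp Require Import zify.

Import Order.TTheory GRing.Theory Num.Theory.
Local Open Scope ring_scope.

Lemma ceil2p_itv (p : nat) (n : int) : (1 <= p)%N ->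
  2 * p%:Z * (ceil2p p n - 1) < n <= 2 * p%:Z * ceil2p p n.
Proof.
move=> hp; have p2 : (0 : rat) < 2 * p%:R by rewrite mulr_gt0 // ltr0n.
have e : (2 * p%:R : rat) = (2 * p%:Z)%:~R by rewrite rmorphM.
have := ceil_itv (n%:~R / (2 * p%:R) : rat); rewrite -/(ceil2p p n).
rewrite ltr_pdivlMr // ler_pdivrMr // e -!rmorphM ltr_int ler_int.
by rewrite !(mulrC _ (2 * _)).
Qed.

Lemma ceil2p_def (p : nat) (n k : int) : (1 <= p)%N ->
  2 * p%:Z * (k - 1) < n <= 2 * p%:Z * k -> ceil2p p n = k.
Proof. by move=> hp; have := ceil2p_itv p n hp; nia. Qed.

Lemma ceil2pD (p : nat) (n k : int) : (1 <= p)%N ->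
  ceil2p p (n + 2 * p%:Z * k) = ceil2p p n + k.
Proof.
by move=> hp; apply: ceil2p_def => //; have := ceil2p_itv p n hp; lia.
Qed.

(* This is ceil(x / p), see [ceilp_itv]. *)
Definition ceilp (p : nat) (x : int) : int := ceil2p p x + ceil2p p (x - p%:Z).

Lemma ceilp_itv (p : nat) (x : int) : (1 <= p)%N ->
  p%:Z * (ceilp p x - 1) < x <= p%:Z * ceilp p x.
Proof.
move=> hp; rewrite /ceilp; set c := ceil2p p x.
have hc : 2 * p%:Z * (c - 1) < x <= 2 * p%:Z * c by exact: ceil2p_itv.
case: (lerP x (2 * p%:Z * c - p%:Z)) => h.
  by rewrite (ceil2p_def p (x - p%:Z) (c - 1)) //; lia.
by rewrite (ceil2p_def p (x - p%:Z) c) //; lia.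
Qed.

Lemma ceilp_def (p : nat) (x k : int) : (1 <= p)%N ->
  p%:Z * (k - 1) < x <= p%:Z * k -> ceilp p x = k.
Proof. by move=> hp; have := ceilp_itv p x hp; nia. Qed.

(** With m = [(q %/ 2)%Z], the integers from pq + 1 to pq + p form the lower or upper half of the
    block from 2pm + 1 to 2pm + 2p, according to the parity of q; on that block [ceil2p] is m +
    1. *)
Lemma ceil2p_block (p : nat) (q u : int) : (1 <= p)%N -> 1 <= u <= p%:Z ->
  ceil2p p (p%:Z * q + u) = ceil2p p (p%:Z * q + p%:Z).
Proof.
move=> hp hu; have /orP[/eqP e|/eqP e] :
    (q == 2 * (q %/ 2)%Z) || (q == 2 * (q %/ 2)%Z + 1) by lia.
  by rewrite !(ceil2p_def p _ ((q %/ 2)%Z + 1)) //; nia.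
by rewrite !(ceil2p_def p _ ((q %/ 2)%Z + 1)) //; nia.
Qed.

Definition below (p : nat) (a : 'I_p -> int) (r : int) : nat :=
  #|[set i | zhat p (a i) < r]|.

Lemma zhat_itv (p : nat) (z : int) : (1 <= p)%N -> 0 <= zhat p z < 2 * p%:Z.
Proof. by move=> hp; rewrite modz_ge0 ?ltz_pmod //; lia. Qed.

Lemma below_leq_card (p : nat) (a : 'I_p -> int) (r : int) :
  (below p a r <= p)%N.
Proof. by rewrite -[X in (_ <= X)%N]card_ord max_card. Qed.

Lemma below_all (p : nat) (a : 'I_p -> int) : (1 <= p)%N ->
  below p a (2 * p%:Z) = p.
Proof.
move=> hp; rewrite -[RHS]card_ord; apply: eq_card => i.
by rewrite !inE; have := zhat_itv p (a i) hp; lia.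
Qed.

(** After the multiples of 2p are split off, each term leaves the ceiling of (r -
    [zhat p (a i)])/2p. Its numerator lies in (-2p, 2p], so it is 1 if the residue is below r and 0
    otherwise. *)
Lemma sum_ceil2p (p : nat) (a : 'I_p -> int) (q r : int) : (1 <= p)%N ->
  0 <= r <= 2 * p%:Z ->
  \sum_(i < p) ceil2p p (2 * p%:Z * q + r - a i)
  = p%:Z * q - \sum_(i < p) zbar p (a i) + (below p a r)%:Z.
Proof.
move=> hp hr.
have e i : ceil2p p (2 * p%:Z * q + r - a i)
    = q - zbar p (a i) + (nat_of_bool (zhat p (a i) < r))%:Z.
  have ea : a i = zbar p (a i) * (2 * p%:Z) + zhat p (a i) by exact: divz_eq.
  have := zhat_itv p (a i) hp; move: ea.
  move: (zbar _ _) (zhat _ _) => z h -> hh.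
  by apply: ceil2p_def => //; case: (ltrP h r) => /= hhr; lia.
rewrite (eq_bigr _ (fun i _ => e i)) !big_split /= sumrN sumr_const card_ord.
rewrite -[q *+ p]mulr_natl natz; congr (_ + _).
rewrite /below -sum1_card -natz natr_sum [RHS]big_mkcond /=.
by apply: eq_bigr => i _; rewrite inE; case: (_ < _).
Qed.

(** For r <= p only the lower bound has content, and it is the first condition at j = r - 1. For r >
    p only the upper bound has content, since at most p residues are counted, and it is the second
    condition at j = 2p - r. *)
Lemma residues_spreadE (p : nat) (a : 'I_p -> int) : (1 <= p)%N ->
  residues_spread a <->
  forall r : int, 1 <= r <= 2 * p%:Z -> 1 <= r - (below p a r)%:Z <= p%:Z.
Proof.
move=> hp.
have low (j : nat) : #|[set i | zhat p (a i) <= j%:Z]| = below p a (j%:Z + 1).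
  by apply: eq_card => i; rewrite !inE; lia.
have high (j : nat) : #|[set i | 2 * p%:Z - j%:Z <= zhat p (a i)]|
    = (p - below p a (2 * p%:Z - j%:Z)%R)%N.
  have <- : ~: [set i | zhat p (a i) < 2 * p%:Z - j%:Z]
      = [set i | 2 * p%:Z - j%:Z <= zhat p (a i)].
    by apply/setP => i; rewrite !inE -leNgt.
  by rewrite cardsCs setCK card_ord.
split=> [spread r hr | h j hj].
  have hb := below_leq_card p a r.
  case: (lerP r p%:Z) => hrp.
    have [j ej] : exists j : nat, r = j%:Z + 1.
      by exists (absz (r - 1)%R); lia.
    have [|+ _] := spread j; first by lia.
    by rewrite low -ej; lia.
  have [j ej] : exists j : nat, r = 2 * p%:Z - j%:Z.
    by exists (absz (2 * p%:Z - r)%R); lia.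
  have [|_] := spread j; first by lia.
  by move: hr hb hrp; rewrite high ej; lia.
rewrite low high; have := h (j%:Z + 1); have := h (2 * p%:Z - j%:Z).
by lia.
Qed.

Lemma formally_satisfiesE (p : nat) (s t : int) (a b : 'I_p -> int) :
  (1 <= p)%N ->
  formally_satisfies s t a b (ceil2p p) <->
  forall q r : int, 1 <= r <= 2 * p%:Z ->
    q + 1
    = ceil2p p (p%:Z * q + (r - (below p a r)%:Z)
                + (- s + \sum_(i < p) zbar p (a i)))
      + ceil2p p (p%:Z * q + (r - (below p b r)%:Z)
                  + (- t + \sum_(i < p) zbar p (b i))).
Proof.
move=> hp.
have arg (x : int) (c : 'I_p -> int) q r : 1 <= r <= 2 * p%:Z ->
    2 * p%:Z * q + r - x - \sum_(i < p) ceil2p p (2 * p%:Z * q + r - c i)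
    = p%:Z * q + (r - (below p c r)%:Z) + (- x + \sum_(i < p) zbar p (c i)).
  by move=> hr; rewrite sum_ceil2p //; lia.
have lhs q r : 1 <= r <= 2 * p%:Z -> ceil2p p (2 * p%:Z * q + r) = q + 1.
  by move=> hr; apply: ceil2p_def => //; lia.
split=> [h q r hr | h n]; first by rewrite -(lhs q r) // h !arg.
(* Dividing n - 1 rather than n puts the offset in 1..2p, where the left-hand side is constantly q +
   1. *)
have := zhat_itv p (n - 1) hp; rewrite /zhat.
have := divz_eq (n - 1) (2 * p%:Z).
move: (_ %/ _)%Z (_ %% _)%Z => q r e hr.
have -> : n = 2 * p%:Z * q + (r + 1) by lia.
have hr1 : 1 <= r + 1 <= 2 * p%:Z by lia.
by rewrite lhs // !arg // -h.
Qed.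

(** The multiples of 2p contribute d and -d, which cancel. The remaining arguments can be moved to
    pq + p and p(q - 1) + p, and these two values add up to [ceilp] at pq + p. *)
Lemma ceil2p_pair (p : nat) (q u v d : int) : (1 <= p)%N ->
  1 <= u <= p%:Z -> 1 <= v <= p%:Z ->
  ceil2p p (p%:Z * q + u + 2 * p%:Z * d)
  + ceil2p p (p%:Z * q + v + (- (2 * p%:Z * d) - p%:Z)) = q + 1.
Proof.
move=> hp hu hv.
have -> : p%:Z * q + v + (- (2 * p%:Z * d) - p%:Z)
    = (p%:Z * (q - 1) + v) + 2 * p%:Z * (- d) by lia.
rewrite !ceil2pD // !ceil2p_block //.
have := ceilp_def p (p%:Z * q + p%:Z) (q + 1) hp; rewrite /ceilp.
have -> : p%:Z * q + p%:Z - p%:Z = p%:Z * (q - 1) + p%:Z by lia.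
by lia.
Qed.

Lemma ceilpD (p : nat) (x k : int) : (1 <= p)%N ->
  ceilp p (x + p%:Z * k) = ceilp p x + k.
Proof.
by move=> hp; apply: ceilp_def => //; have := ceilp_itv p x hp; lia.
Qed.

(** A step of at most 1 passes at most one multiple of p, and then it starts on that multiple. *)
Lemma ceilp_step (p : nat) (x y : int) : (1 <= p)%N -> y <= x + 1 ->
  ceilp p y <= ceilp p x + 1 /\
  (ceilp p y = ceilp p x + 1 -> x = p%:Z * ceilp p x).
Proof.
move=> hp hxy; have := ceilp_itv p x hp; have := ceilp_itv p y hp.
by split; nia.
Qed.

Section Necessity.
Context (p : nat) (a b : 'I_p -> int) (sigma tau : int).
Context (hp : (1 <= p)%N).
Context (H : forall q r : int, 1 <= r <= 2 * p%:Z ->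
  q + 1 = ceil2p p (p%:Z * q + (r - (below p a r)%:Z) + sigma)
          + ceil2p p (p%:Z * q + (r - (below p b r)%:Z) + tau)).

Lemma ceilp_sum (q r : int) : 1 <= r <= 2 * p%:Z ->
  ceilp p (p%:Z * q + (r - (below p a r)%:Z) + sigma)
  + ceilp p (p%:Z * q + (r - (below p b r)%:Z) + tau) = 2 * q + 1.
Proof.
move=> hr; have := H q r hr; have := H (q - 1) r hr; rewrite /ceilp.
have e (u : int) : p%:Z * (q - 1) + u = p%:Z * q + u - p%:Z by lia.
rewrite !e ![_ - p%:Z + _]addrAC addrACA => <- <-.
by lia.
Qed.

Lemma offsets_multiple :
  sigma = p%:Z * ceilp p sigma /\ tau = p%:Z * ceilp p tau /\
  ceilp p sigma + ceilp p tau = -1.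
Proof.
have : ceilp p sigma + ceilp p tau = -1.
  have := ceilp_sum (-1) (2 * p%:Z); rewrite !below_all //.
  have -> : p%:Z * -1 + (2 * p%:Z - p%:Z) = 0 by lia.
  by rewrite !add0r; lia.
(* The sum of the two ceilings rises from -1 to 1 while each rises by at most 1, so both rise by
   exactly 1. *)
have := ceilp_sum 0 1; rewrite mulr0 !add0r.
have := ceilp_step p sigma (1 - (below p a 1)%:Z + sigma) hp.
have := ceilp_step p tau (1 - (below p b 1)%:Z + tau) hp.
move: (ceilp p (1 - _ + sigma)) (ceilp p (1 - _ + tau)) => k l hb ha h1 h0.
have [|sa sa'] := ha; first by lia.
have [|sb sb'] := hb; first by lia.
by split; [apply: sa' | split=> //; apply: sb']; lia.
Qed.

Lemma residues_spread_of_recurrence : residues_spread a /\ residues_spread b.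
Proof.
have [ea [eb eab]] := offsets_multiple.
suff h (r : int) : 1 <= r <= 2 * p%:Z ->
    1 <= r - (below p a r)%:Z <= p%:Z /\ 1 <= r - (below p b r)%:Z <= p%:Z.
  by split; apply/residues_spreadE => // r /h [].
move=> hr; have := ceilp_sum 0 r hr.
rewrite mulr0 !add0r ea eb !ceilpD // => hK.
have ca := below_leq_card p a r; have cb := below_leq_card p b r.
have ia := ceilp_itv p (r - (below p a r)%:Z) hp.
have ib := ceilp_itv p (r - (below p b r)%:Z) hp.
move: ia ib hK; move: (ceilp p (r - (below p a r)%:Z)).
move: (ceilp p (r - (below p b r)%:Z)) => l k ia ib hK.
have kl : k + l = 2 by lia.
have {kl} [k1 l1] : k = 1 /\ l = 1 by case: (lerP r p%:Z) => hrp; nia.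
by rewrite k1 in ia; rewrite l1 in ib; lia.
Qed.
End Necessity.

Theorem theorem5p3 (p : nat) (s t : int) (a b : 'I_p -> int)
    (hp : (1 <= p)%N) (hs : 0 <= s) (ht : 0 <= t)
    (ha : forall i : 'I_p, 1 <= a i) (hb : forall i : 'I_p, 1 <= b i) :
  formally_satisfies s t a b (ceil2p p) <->
  [/\ residues_spread a,
      residues_spread b &
      exists d : int,
        (- s + \sum_(i < p) zbar p (a i) = 2 * p%:Z * d /\
         - t + \sum_(i < p) zbar p (b i) = - (2 * p%:Z * d) - p%:Z) \/
        (- s + \sum_(i < p) zbar p (a i) = - (2 * p%:Z * d) - p%:Z /\
         - t + \sum_(i < p) zbar p (b i) = 2 * p%:Z * d)].
Proof.
rewrite formally_satisfiesE //.
move: (- s + _) (- t + _) => sigma tau; split=> [H | [sa sb [d hd]] q r hr].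
  have [sa sb] := residues_spread_of_recurrence p a b sigma tau hp H.
  split=> //; have [ea [eb e]] := offsets_multiple p a b sigma tau hp H.
  move: ea eb e; move: (ceilp p sigma) (ceilp p tau) => k l -> -> e.
  have -> : l = - k - 1 by lia.
  (* The quotients k and -k - 1 have opposite parity; the even one is 2d, and its place selects the
     alternative. *)
  have /orP[/eqP ->|/eqP ->] :
      (k == 2 * (k %/ 2)%Z) || (k == 2 * (k %/ 2)%Z + 1) by lia.
    by exists (k %/ 2)%Z; left; lia.
  by exists (- (k %/ 2)%Z - 1); right; lia.
move/(residues_spreadE p a hp)/(_ r hr): sa => ua.
move/(residues_spreadE p b hp)/(_ r hr): sb => ub.
(* The second alternative is the first with the two summands exchanged. *)
by symmetry; case: hd => -[-> ->]; [|rewrite addrC]; exact: ceil2p_pair.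
Qed.
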